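(* Let $\widehat{G}$ be a signed bigraph whose underlying bigraph is non-separable. Then $\widehat{G}$ is chordal if and only if it does not contain any signed graph in $F_1\cup F_2\cup\cdots\cup F_6$ as an induced subgraph, where: $F_1$: $K_{2,2}$ with all four edges negative; $F_2$: complete bigraph with parts $\{a_1,a_2\}$, $\{b_1,b_2,b_3\}$, $a_1b_1,a_1b_2,a_2b_2,a_2b_3$ negative, $a_1b_3,a_2b_1$ free; $F_3$: complete bigraph with parts $\{a_1,a_2\}$, $\{b_1,\dots,b_4\}$, $a_1b_1,a_1b_2,a_2b_3,a_2b_4$ negative, the other four edges free; $F_4$: complete bigraph with parts $\{a_1,a_2,a_3\}$, $\{b_1,b_2,b_3\}$, $a_1b_1,a_2b_2,a_3b_3$ negative, the other six edges free; $F_5$: bigraph with parts $\{a_1,a_2,a_3\}$, $\{b_1,b_2,b_3\}$ having all nine possible edges except $a_1b_3$, with $a_2b_1,a_3b_2$ negative and the other six edges free; $F_6$: bigraph with parts $\{a_1,\dots,a_4\}$, $\{b_1,\dots,b_4\}$ in which $a_1,a_2$ are adjacent exactly to $b_1,b_2$ and $a_3,a_4$ are adjacent to all of $b_1,\dots,b_4$, with $a_1b_1,a_2b_1,a_3b_2,a_4b_3,a_4b_4$ negative and the other seven edges free.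
   Context: A signed graph is a finite simple graph each of whose edges is assigned a sign, positive or negative. A signed bigraph is a signed graph whose underlying graph is bipartite, with bipartition $(X,Y)$. A bigraph is separable if it contains an induced $2K_2$, non-separable otherwise. An induced subgraph is obtained by deleting vertices only (signs are inherited); $\widehat G$ contains $H$ as an induced subgraph if some induced subgraph of $\widehat G$ is isomorphic to $H$ via a sign-preserving isomorphism. A signed graph is positive if all its edges are positive. In a bigraph with bipartition $(X,Y)$, a subgraph $H$ is a biclique if every vertex of $V(H)\cap X$ is adjacent to every vertex of $V(H)\cap Y$. For an edge $uv$, $N(uv)=(N(u)\cup N(v))\setminus\{u,v\}$. An edge $uv$ of a signed bigraph is signed simplicial if $N(uv)$ induces a positive biclique. A signed bigraph $\widehat G$ is chordal if its edges can be ordered $e_1,\dots,e_m$ so that each $e_i$ is signed simplicial in the signed bigraph $\widehat G-\{e_1,\dots,e_{i-1}\}$ obtained by deleting these edges (but no vertices). A family described by a graph with some edges declared negative, some positive, and the rest declared free, is the set of all signed graphs obtained by giving each free edge an arbitrary sign. *)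

(* Defs.v *)
From mathcomp Require Import all_boot.
Set Implicit Arguments. Unset Strict Implicit. Unset Printing Implicit Defensive.

(* A signed graph on a finite vertex type T is given by an adjacency relation
   [adj] (symmetric, irreflexive) and a relation [neg] marking negative edges
   (symmetric, contained in [adj]); edges with [adj x y && ~~ neg x y] are
   positive.  A signed bigraph additionally has a bipartition given by
   [side : T -> bool] (X = side true, Y = side false) with every edge joining
   the two sides. *)
Definition signed_graph (T : finType) (adj neg : rel T) : Prop :=
  symmetric adj /\ irreflexive adj /\ symmetric neg /\
  (forall x y, neg x y -> adj x y).

Definition signed_bigraph (T : finType) (side : T -> bool) (adj neg : rel T) : Prop :=
  signed_graph adj neg /\ (forall x y, adj x y -> side x != side y).

Definition separable (T : finType) (adj : rel T) : Prop :=
  exists x1 y1 x2 y2 : T,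
    uniq [:: x1; y1; x2; y2] /\ adj x1 y1 /\ adj x2 y2 /\
    ~~ adj x1 x2 /\ ~~ adj x1 y2 /\ ~~ adj y1 x2 /\ ~~ adj y1 y2.

Definition inN (T : finType) (a : rel T) (u v x : T) : bool :=
  [&& (a u x || a v x), x != u & x != v].

Definition signed_simplicial (T : finType) (side : T -> bool) (a neg : rel T)
    (u v : T) : bool :=
  [forall x, forall y,
    [&& inN a u v x, inN a u v y, side x & ~~ side y] ==> a x y] &&
  [forall x, forall y, [&& inN a u v x, inN a u v y & a x y] ==> ~~ neg x y].

Definition del_edges (T : finType) (adj : rel T) (D : seq (T * T)%type) : rel T :=
  fun x y => [&& adj x y, (x, y) \notin D & (y, x) \notin D].

(* edges, each listed once as (x, y) with x in X and y in Y *)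
Definition edge_list (T : finType) (side : T -> bool) (adj : rel T) : seq (T * T)%type :=
  [seq p <- enum {: (T * T)%type} | side p.1 && adj p.1 p.2].

Definition chordal (T : finType) (side : T -> bool) (adj neg : rel T) : Prop :=
  exists s : seq (T * T)%type,
    perm_eq s (edge_list side adj) /\
    forall (s1 s2 : seq (T * T)%type) (e : (T * T)%type), s = s1 ++ e :: s2 ->
      signed_simplicial side (del_edges adj s1) neg e.1 e.2.

Definition contains_induced (T H : finType) (adj neg : rel T) (adjH negH : rel H)
    : Prop :=
  exists f : H -> T, injective f /\
    forall x y, adj (f x) (f y) = adjH x y /\
                (adjH x y -> neg (f x) (f y) = negH x y).

(* A bigraph on parts {a_0..a_(m-1)} (inl) and {b_0..b_(n-1)} (inr), with
   a_i b_j an edge iff [ab i j].  (Indices are 0-based: paper's a_(i+1).) *)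
Definition bip_adj (m n : nat) (ab : nat -> nat -> bool) : rel ('I_m + 'I_n) :=
  fun x y => match x, y with
             | inl i, inr j => ab i j
             | inr j, inl i => ab i j
             | _, _ => false
             end.

(* Family described by edges [ab], negative edges [fn] (a subset of [ab]),
   all other edges free: the signed graphs on that underlying graph in which
   every edge of [fn] is negative (free edges have arbitrary sign). *)
Definition in_family (m n : nat) (ab fn : nat -> nat -> bool)
    (negH : rel ('I_m + 'I_n)) : Prop :=
  signed_graph (@bip_adj m n ab) negH /\
  forall (i : 'I_m) (j : 'I_n), ab i j -> fn i j -> negH (inl i) (inr j).

Definition contains_family (T : finType) (adj neg : rel T) (m n : nat)
    (ab fn : nat -> nat -> bool) : Prop :=
  exists negH : rel ('I_m + 'I_n),
    @in_family m n ab fn negH /\ contains_induced adj neg (@bip_adj m n ab) negH.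

Definition F1_ab (i j : nat) : bool := true.
Definition F1_neg (i j : nat) : bool := true.
Definition F2_ab (i j : nat) : bool := true.
Definition F2_neg (i j : nat) : bool :=
  ((i, j) == (0, 0)) || ((i, j) == (0, 1)) || ((i, j) == (1, 1)) || ((i, j) == (1, 2)).
Definition F3_ab (i j : nat) : bool := true.
Definition F3_neg (i j : nat) : bool :=
  ((i, j) == (0, 0)) || ((i, j) == (0, 1)) || ((i, j) == (1, 2)) || ((i, j) == (1, 3)).
Definition F4_ab (i j : nat) : bool := true.
Definition F4_neg (i j : nat) : bool := i == j.
Definition F5_ab (i j : nat) : bool := (i, j) != (0, 2).
Definition F5_neg (i j : nat) : bool := ((i, j) == (1, 0)) || ((i, j) == (2, 1)).
Definition F6_ab (i j : nat) : bool := (2 <= i) || (j < 2).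
Definition F6_neg (i j : nat) : bool :=
  ((i, j) == (0, 0)) || ((i, j) == (1, 0)) || ((i, j) == (2, 1)) ||
  ((i, j) == (3, 2)) || ((i, j) == (3, 3)).

(* Main.v *)
(* A chordal signed bigraph contains none of the families because the edges of
   an induced copy block one another: the first of them to be deleted cannot be
   signed simplicial.

   Conversely, neighborhoods in a non-separable bigraph are nested, and the
   edges are deleted row by row (rows are the vertices of X).  The edges at a
   row u can be deleted consecutively as soon as, for any two neighbors y, y' of
   u, one dominates the other: every other row adjacent to y is adjacent to y'
   by a positive edge, or vice versa.  Such a row exists unless one of the
   families occurs.  Let C be the neighborhood of a row u0 of minimal degree.
   - If some row has two negative edges to C, it can be cleared.
   - Otherwise, if no row with neighborhood C can be cleared, excluding F3, F4
     and F5 leaves in C one column with at least two negative edges, all to rows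
     with neighborhood C, and one column with a single negative edge, to a row r
     whose neighborhood is larger than C; excluding F6, r can be cleared. *)
Require Import Defs.
From mathcomp Require Import all_boot.
Set Implicit Arguments. Unset Strict Implicit. Unset Printing Implicit Defensive.

Section SignedBigraph.

Variables (T : finType) (side : T -> bool) (adj neg : rel T).
Hypothesis bigraph : signed_bigraph side adj neg.

Let adjC : symmetric adj. Proof. by case: bigraph => -[]. Qed.
Let negC : symmetric neg. Proof. by case: bigraph => -[_ [_ []]]. Qed.
Let neg_adj x y : neg x y -> adj x y.
Proof. by case: bigraph => -[_ [_ [_]]] h _; apply: h. Qed.
Let adj_side x y : adj x y -> side y = ~~ side x.
Proof. by case: bigraph => _ h /h; case: (side x); case: (side y). Qed.

(** * Signed simplicial edges and induced copies of the patterns *)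

Lemma del_edgesC D : symmetric (del_edges adj D).
Proof. by move=> x y; rewrite /del_edges adjC [X in _ && X]andbC. Qed.

(** In a bigraph the only pairs in [N(uv)] that matter have one vertex next to [v] and the other
    next to [u], so the biclique and positivity conditions merge into one, whichever endpoint lies
    in [X]. *)
Lemma signed_simplicialP D u v : del_edges adj D u v ->
  reflect (forall x y, x != u -> y != v -> del_edges adj D x v ->
             del_edges adj D u y -> del_edges adj D x y && ~~ neg x y)
          (signed_simplicial side (del_edges adj D) neg u v).
Proof.
set a := del_edges adj D => auv.
have aC : symmetric a := del_edgesC D.
have a_side x y : a x y -> side y = ~~ side x by case/andP=> /adj_side.
apply: (iffP andP) => [[/forallP bicl /forallP pos] x y xu yv axv auy|h].
  have Nx : inN a u v x.
    rewrite /inN [a v x]aC axv orbT xu /=; apply: contraTneq auv => xv.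
    by move/a_side: axv; rewrite xv; case: (side v).
  have Ny : inN a u v y.
    rewrite /inN auy yv andbT /=; apply: contraTneq auy => yu.
    by apply/negP => /a_side; rewrite yu; case: (side u).
  have axy : a x y.
    case: (boolP (side x)) => sx.
      have sy : ~~ side y by rewrite (a_side _ _ auy) -(a_side _ _ auv) (a_side _ _ axv) sx.
      by move/forallP/(_ y): (bicl x); rewrite Nx Ny sx sy.
    have sy : side y by rewrite (a_side _ _ auy) -(a_side _ _ auv) (a_side _ _ axv).
    by rewrite aC; move/forallP/(_ x): (bicl y); rewrite Nx Ny sx sy.
  by rewrite axy; move/forallP/(_ y): (pos x); rewrite Nx Ny axy.
have key x y : inN a u v x -> inN a u v y -> side x != side y ->
    a x y && ~~ neg x y.
  have wlog_key x' y' : inN a u v x' -> inN a u v y' -> a x' v -> side x' != side y' ->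
      a x' y' && ~~ neg x' y'.
    case/and3P=> _ xu _ /and3P[/orP[ay|ay] _ yv] axv sxy; first exact: h.
    by move: sxy; rewrite (a_side _ _ ay) (a_side _ _ axv) negbK eqxx.
  move=> Nx Ny sxy; case/and3P: (Nx) => /orP[ax|ax] xu xv; last first.
    by apply: wlog_key => //; rewrite aC.
  rewrite aC negC; apply: (wlog_key _ _ Ny Nx); last by rewrite eq_sym.
  case/and3P: (Ny) => /orP[ay|ay] _ _; last by rewrite aC.
  by move: sxy; rewrite (a_side _ _ ay) (a_side _ _ ax) eqxx.
split; apply/forallP=> x; apply/forallP=> y; apply/implyP.
  case/and4P=> Nx Ny sx sy.
  by have /andP[] := key x y Nx Ny ltac:(by rewrite sx (negPf sy)).
case/and3P=> Nx Ny axy.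
by have /andP[] := key x y Nx Ny ltac:(by rewrite (a_side _ _ axy); case: (side x)).
Qed.

(* For every edge [a_i b_j] some neighbour of [b_j] and some neighbour of [a_i]
   are non-adjacent or joined by a negative edge, so no edge of the pattern is
   signed simplicial, and none can be the first one to be deleted. *)
Definition stuck (m n : nat) (ab fn : nat -> nat -> bool) : bool :=
  all (fun i => all (fun j => ab i j ==>
    has (fun i' => has (fun j' =>
      [&& i' != i, j' != j, ab i' j, ab i j' & ab i' j' ==> fn i' j'])
    (iota 0 n)) (iota 0 m)) (iota 0 n)) (iota 0 m).

Lemma stuck_not_chordal m n (ab fn : nat -> nat -> bool) :
  stuck m.+1 n.+1 ab fn -> ab m n ->
  contains_family adj neg m.+1 n.+1 ab fn -> ~ chordal side adj neg.
Proof.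
move=> /allP stk ab0 [negH [[[_ [_ [_ _]]] fnP] [f [f_inj fP]]]] [s [s_edges s_ok]].
(* Both orientations are allowed, since the rows of the copy may lie in [X] or in [Y]. *)
pose P (e : T * T) := [exists i : 'I_m.+1, exists j : 'I_n.+1, ab i j &&
  ((e == (f (inl i), f (inr j))) || (e == (f (inr j), f (inl i))))].
have fadj (i : 'I_m.+1) (j : 'I_n.+1) : adj (f (inl i)) (f (inr j)) = ab i j.
  by case: (fP (inl i) (inr j)).
have has_s : has P s.
  rewrite (perm_has P s_edges).
  have adj0 : adj (f (inl ord_max)) (f (inr ord_max)) by rewrite fadj.
  apply/hasP; case: (boolP (side (f (inl ord_max)))) => s0.
    exists (f (inl ord_max), f (inr ord_max)).
      by rewrite mem_filter mem_enum /= s0 adj0.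
    by apply/existsP; exists ord_max; apply/existsP; exists ord_max; rewrite ab0 eqxx.
  exists (f (inr ord_max), f (inl ord_max)).
    by rewrite mem_filter mem_enum /= (adj_side adj0) s0 adjC adj0.
  by apply/existsP; exists ord_max; apply/existsP; exists ord_max; rewrite ab0 eqxx orbT.
(* [e] is the first edge of the copy to be deleted, so the whole copy survives in [a]. *)
case s_eq: {1}s _ _ / (split_find has_s) => [e s1 s2 Pe s1P].
pose a := del_edges adj s1.
have fa (i : 'I_m.+1) (j : 'I_n.+1) : ab i j -> a (f (inl i)) (f (inr j)).
  move=> abij; rewrite /a /del_edges fadj abij /=.
  have notin e' : P e' -> e' \notin s1.
    by move=> Pe'; apply: contra s1P => e's1; apply/hasP; exists e'.
  by rewrite !notin //; apply/existsP; exists i; apply/existsP; exists j;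
    rewrite abij eqxx ?orbT.
have [i [j [abij e_ij]]] : exists (i : 'I_m.+1) (j : 'I_n.+1), ab i j /\
    (e = (f (inl i), f (inr j)) \/ e = (f (inr j), f (inl i))).
  case/existsP: Pe => i /existsP[j /andP[abij /orP[]/eqP e_ij]].
    by exists i, j; split=> //; left.
  by exists i, j; split=> //; right.
have /allP/(_ j) := stk i ltac:(by rewrite mem_iota ltn_ord).
rewrite mem_iota ltn_ord abij => /(_ isT) /hasP[i' i'm] /hasP[j' j'n].
case/and5P=> i'i j'j abi'j abij' bad.
rewrite mem_iota in i'm; rewrite mem_iota in j'n.
pose i1 := Ordinal i'm; pose j1 := Ordinal j'n.
have neq_i : f (inl i1) != f (inl i).
  by apply: contra_neq i'i => /f_inj [] <-.
have neq_j : f (inr j1) != f (inr j).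
  by apply: contra_neq j'j => /f_inj [] <-.
have : a (f (inl i1)) (f (inr j1)) && ~~ neg (f (inl i1)) (f (inr j1)).
  have := s_ok s1 s2 e; rewrite -cat_rcons => /(_ s_eq).
  case: e_ij => -> /= /signed_simplicialP h.
    by apply: h => //; apply: fa.
  rewrite /a del_edgesC negC; apply: h => //; rewrite del_edgesC; exact: fa.
case/andP=> /andP[+ _]; rewrite fadj => ab1 /negP[].
have [_ ->] // := fP (inl i1) (inr j1).
by apply: fnP => //; move: bad; rewrite ab1.
Qed.

(** The full column 0 and the full last row force [s] to one side and [t] to the other, hence the
    non-adjacencies inside each part. No side is prescribed for [s], so patterns can also be
    exhibited transposed. *)
Lemma contains_familyI x0 (s t : seq T) (ab fn : nat -> nat -> bool) :
  uniq s -> uniq t ->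
  all (fun i => ab i 0) (iota 0 (size s)) ->
  all (ab (size s).-1) (iota 0 (size t)) ->
  all (fun i => all (fun j =>
      (adj (nth x0 s i) (nth x0 t j) == ab i j) &&
      (ab i j && fn i j ==> neg (nth x0 s i) (nth x0 t j)))
    (iota 0 (size t))) (iota 0 (size s)) ->
  0 < size s -> 0 < size t ->
  contains_family adj neg (size s) (size t) ab fn.
Proof.
move=> us ut /allP ab0 /allP abm /allP stP s_gt0 t_gt0.
have ijP i j : i < size s -> j < size t -> adj (nth x0 s i) (nth x0 t j) = ab i j.
  move=> lti ltj; have /allP/(_ j) := stP i ltac:(by rewrite mem_iota).
  by rewrite mem_iota => /(_ ltj) /andP[/eqP].
pose b := side (nth x0 s (size s).-1).
have lt_m : (size s).-1 < size s by rewrite prednK.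
have st y : y \in t -> side y == ~~ b.
  case/(nthP x0)=> j ltj <-; apply/eqP/adj_side.
  by rewrite ijP // abm // mem_iota.
have ss x : x \in s -> side x == b.
  case/(nthP x0)=> i lti <-; have := @adj_side (nth x0 s i) (nth x0 t 0).
  rewrite ijP // ab0 ?mem_iota // => /(_ isT).
  by rewrite (eqP (st _ (mem_nth _ t_gt0))) => /negb_inj ->.
pose f (p : 'I_(size s) + 'I_(size t)) :=
  match p with inl i => nth x0 s i | inr j => nth x0 t j end.
have fP p q : adj (f p) (f q) = @bip_adj (size s) (size t) ab p q.
  have same b' x y : side x == b' -> side y == b' -> adj x y = false.
    move=> /eqP sx /eqP sy; apply/negP => /adj_side.
    by rewrite sx sy {sx sy}; case: b'.
  case: p q => [i|j] [i'|j'].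
  - by apply: (same b); apply: ss; apply: mem_nth.
  - exact: ijP.
  - by rewrite adjC; apply: ijP.
  by apply: (same (~~ b)); apply: st; apply: mem_nth.
exists (fun p q => neg (f p) (f q)); split; last first.
  exists f; split=> [[i|j] [i'|j'] //= fpq|p q //].
  - by congr inl; apply/val_inj/eqP; rewrite -(nth_uniq x0 _ _ us) ?ltn_ord // fpq.
  - have := ss _ (mem_nth x0 (ltn_ord i)); rewrite fpq (eqP (st _ (mem_nth x0 (ltn_ord j')))).
    by case: (b).
  - have := ss _ (mem_nth x0 (ltn_ord i')); rewrite -fpq (eqP (st _ (mem_nth x0 (ltn_ord j)))).
    by case: (b).
  by congr inr; apply/val_inj/eqP; rewrite -(nth_uniq x0 _ _ ut) ?ltn_ord // fpq.
split; last first.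
  move=> i j abij fnij; have /allP/(_ j) := stP i ltac:(by rewrite mem_iota ltn_ord).
  by rewrite mem_iota ltn_ord abij fnij => /(_ isT) /andP[].
split; [|split; [|split]].
- by move=> p q; rewrite -!fP adjC.
- by case.
- by move=> p q; rewrite negC.
by move=> p q /neg_adj; rewrite fP.
Qed.

(** * Forbidden configurations in a non-separable bigraph *)

Hypothesis nonsep : ~ separable adj.
Hypothesis free :
   ~ (contains_family adj neg 2 2 F1_ab F1_neg \/
      contains_family adj neg 2 3 F2_ab F2_neg \/
      contains_family adj neg 2 4 F3_ab F3_neg \/
      contains_family adj neg 3 3 F4_ab F4_neg \/
      contains_family adj neg 3 3 F5_ab F5_neg \/
      contains_family adj neg 4 4 F6_ab F6_neg).

(** Otherwise the edges [x y] and [x' y'] would induce a $2K_2$. *)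
Lemma neighborhoods_nested x y x' y' : side x = side x' ->
  adj x y -> adj x' y' -> adj x y' || adj x' y.
Proof.
move=> sxx' axy ax'y'; apply: contra_notT nonsep => /norP[nxy' nx'y].
have sy := adj_side axy; have sy' := adj_side ax'y'.
have same u v : side u = side v -> ~~ adj u v.
  by move=> suv; apply/negP => /adj_side; rewrite suv; case: (side v).
have diff u v : side v = ~~ side u -> u != v.
  by move=> suv; apply: contra_eq_neq suv => ->; case: (side v).
exists x, y, x', y'; split.
  have xx' : x != x' by apply: contraNneq nx'y => <-.
  have yy' : y != y' by apply: contraNneq nxy' => <-.
  rewrite /= !inE !negb_or xx' yy' (diff x y) // (diff x y') ?sxx' //=.
  by rewrite (diff x' y') // (diff y x') // sy sxx' negbK.
split=> //; split=> //; split; first exact: same.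
split=> //; split; first by rewrite adjC.
by apply: same; rewrite sy sy' sxx'.
Qed.

Ltac exhibit s t :=
  match s with ?x :: _ =>
    apply: (@contains_familyI x s t); rewrite //= ?inE ?negb_or;
    repeat match goal with
    | H : is_true (neg _ _) |- _ => rewrite ?(neg_adj H) ?H; clear H
    | H : is_true (adj _ _) |- _ => rewrite ?H; clear H
    | H : is_true (~~ adj _ _) |- _ => rewrite ?(negPf H); clear H
    | H : is_true (~~ (_ == _)) |- _ => rewrite ?H; clear H
    end; rewrite //
  end.

Lemma no_F1 x x' y y' : x != x' -> y != y' ->
  neg x y -> neg x y' -> neg x' y -> neg x' y' -> False.
Proof.
by move=> xx' yy' n1 n2 n3 n4; apply: free; left; exhibit [:: x; x'] [:: y; y'].
Qed.

Lemma no_F2 x x' y1 y2 y3 : x != x' -> y1 != y2 -> y1 != y3 -> y2 != y3 ->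
  neg x y1 -> neg x y2 -> neg x' y2 -> neg x' y3 -> adj x y3 -> adj x' y1 -> False.
Proof.
by move=> *; apply: free; right; left; exhibit [:: x; x'] [:: y1; y2; y3].
Qed.

Lemma no_F3 x x' y1 y2 y3 y4 : x != x' -> uniq [:: y1; y2; y3; y4] ->
  neg x y1 -> neg x y2 -> neg x' y3 -> neg x' y4 ->
  adj x y3 -> adj x y4 -> adj x' y1 -> adj x' y2 -> False.
Proof.
move=> xx' us *; apply: free; do 2 right; left.
by exhibit [:: x; x'] [:: y1; y2; y3; y4].
Qed.

Lemma no_F4 x1 x2 x3 y1 y2 y3 : x1 != x2 -> x1 != x3 -> x2 != x3 ->
  y1 != y2 -> y1 != y3 -> y2 != y3 ->
  neg x1 y1 -> neg x2 y2 -> neg x3 y3 ->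
  adj x1 y2 -> adj x1 y3 -> adj x2 y1 -> adj x2 y3 -> adj x3 y1 -> adj x3 y2 -> False.
Proof.
move=> *; apply: free; do 3 right; left.
by exhibit [:: x1; x2; x3] [:: y1; y2; y3].
Qed.

(** The remaining distinctness conditions follow from the missing edge [x1 y3]. *)
Lemma no_F5 x1 x2 x3 y1 y2 y3 : x2 != x3 -> y1 != y2 ->
  neg x2 y1 -> neg x3 y2 -> adj x1 y1 -> adj x1 y2 -> ~~ adj x1 y3 ->
  adj x2 y2 -> adj x2 y3 -> adj x3 y1 -> adj x3 y3 -> False.
Proof.
move=> x23 y12 n21 n32 a11 a12 a13 a22 a23 a31 a33; apply: free; do 4 right; left.
have x12 : x1 != x2 by apply: contraNneq a13 => ->.
have x13 : x1 != x3 by apply: contraNneq a13 => ->.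
have y13 : y1 != y3 by apply: contraNneq a13 => <-.
have y23 : y2 != y3 by apply: contraNneq a13 => <-.
by exhibit [:: x1; x2; x3] [:: y1; y2; y3].
Qed.

Lemma no_F6 x1 x2 x3 x4 y1 y2 y3 y4 :
  x1 != x2 -> x3 != x4 -> y1 != y2 -> y3 != y4 ->
  neg x1 y1 -> neg x2 y1 -> neg x3 y2 -> neg x4 y3 -> neg x4 y4 ->
  adj x1 y2 -> adj x2 y2 -> adj x3 y1 -> adj x3 y3 -> adj x3 y4 ->
  adj x4 y1 -> adj x4 y2 ->
  ~~ adj x1 y3 -> ~~ adj x1 y4 -> ~~ adj x2 y3 -> ~~ adj x2 y4 -> False.
Proof.
move=> x12 x34 y12 y34 n11 n21 n32 n43 n44 a12 a22 a31 a33 a34 a41 a42.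
move=> a13 a14 a23 a24; apply: free; do 5 right.
have x13 : x1 != x3 by apply: contraNneq a13 => ->.
have x14 : x1 != x4 by apply: contraNneq a13 => ->; apply: neg_adj.
have x23 : x2 != x3 by apply: contraNneq a23 => ->.
have x24 : x2 != x4 by apply: contraNneq a23 => ->; apply: neg_adj.
have y13 : y1 != y3 by apply: contraNneq a13 => <-; apply: neg_adj.
have y14 : y1 != y4 by apply: contraNneq a14 => <-; apply: neg_adj.
have y23 : y2 != y3 by apply: contraNneq a13 => <-.
have y24 : y2 != y4 by apply: contraNneq a14 => <-.
by exhibit [:: x1; x2; x3; x4] [:: y1; y2; y3; y4].
Qed.

(** The pairs [y1, y2] and [z1, z2] share two, one or no columns, which is excluded by [no_F1],
    [no_F2] or [no_F3]. *)
Lemma no_two_heavy x x' y1 y2 z1 z2 : x != x' -> y1 != y2 -> z1 != z2 ->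
  neg x y1 -> neg x y2 -> neg x' z1 -> neg x' z2 ->
  adj x z1 -> adj x z2 -> adj x' y1 -> adj x' y2 -> False.
Proof.
move=> xx' yy zz n1 n2 n3 n4 a1 a2 a3 a4.
have [e11|d11] := eqVneq y1 z1.
  subst z1; have [e22|d22] := eqVneq y2 z2.
    by subst z2; apply: (no_F1 xx' yy).
  by apply: (@no_F2 x x' y2 y1 z2) => //; rewrite eq_sym.
have [e12|d12] := eqVneq y1 z2.
  subst z2; have [e21|d21] := eqVneq y2 z1.
    by subst z1; apply: (no_F1 xx' yy).
  by apply: (@no_F2 x x' y2 y1 z1) => //; rewrite eq_sym.
have [e21|d21] := eqVneq y2 z1.
  by subst z1; apply: (@no_F2 x x' y1 y2 z2).
have [e22|d22] := eqVneq y2 z2.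
  by subst z2; apply: (@no_F2 x x' y1 y2 z1) => //; rewrite eq_sym.
by apply: (@no_F3 x x' y1 y2 z1 z2); rewrite //= !inE !negb_or yy zz d11 d12 d21 d22.
Qed.

(** * Domination between columns and clearable rows *)

Definition dominates (A : {set T}) (u y y' : T) : bool :=
  [forall x in A, (x != u) ==> adj x y ==> adj x y' && ~~ neg x y'].

(* The edges at [u] can be deleted one by one inside the subgraph whose rows
   are [A], a column being handled before those that dominate it. *)
Definition clearable (A : {set T}) (u : T) : bool :=
  [forall y, forall y', [&& adj u y, adj u y' & y != y'] ==>
     dominates A u y y' || dominates A u y' y].

Lemma dominatesPn A u y y' : ~~ dominates A u y y' ->
  exists x, [/\ x \in A, x != u, adj x y & adj x y' -> neg x y'].
Proof.
case/forallPn=> x; rewrite !negb_imply => /and4P[xA xu xy].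
by rewrite negb_and negbK => /orP[/negPf n|n]; exists x; split; rewrite ?n.
Qed.

(** Domination may fail through a missing edge or a negative one. By nestedness the two failures are
    not both missing edges, and swapping the columns makes the first one negative. *)
Lemma not_clearable (A : {set T}) u : {in A, forall x, side x} -> ~~ clearable A u ->
  exists y y' x x', [/\ [/\ adj u y, adj u y' & y != y'],
    [/\ x \in A, x != u, adj x y & neg x y'] &
    [/\ x' \in A, x' != u, adj x' y' & adj x' y -> neg x' y]].
Proof.
move=> A_side /forallPn[y /forallPn[y']]; rewrite negb_imply negb_or.
case/andP=> /and3P[uy uy' yy'] /andP[/dominatesPn[x [xA xu xy xy']]].
case/dominatesPn=> x' [x'A x'u x'y' x'y].
have [axy'|naxy'] := boolP (adj x y').
  by exists y, y', x, x'; split=> //; split=> //; apply: xy'.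
have := neighborhoods_nested _ xy x'y'; rewrite (negPf naxy') !A_side // => /(_ erefl) ax'y.
exists y', y, x', x; split; split=> //; last exact: x'y.
by rewrite eq_sym.
Qed.

(** * Comparison with a row of minimal degree *)

Section LiveRows.

Variable A : {set T}.
Hypothesis A_side : {in A, forall x, side x}.

Definition live x := (x \in A) && [exists y, adj x y].

Variable u0 : T.
Hypothesis live_u0 : live u0.
Hypothesis min_u0 : forall x, live x -> #|[set y | adj u0 y]| <= #|[set y | adj x y]|.

(** By nestedness, a row missing [y] would have its neighborhood strictly inside that of [u0]. *)
Lemma min_row_sub x y : live x -> adj u0 y -> adj x y.
Proof.
move=> xl u0y; apply: contraT => nxy; have := min_u0 xl; rewrite leqNgt => /negP[].
apply: proper_card; apply/properP; split; last by exists y; rewrite inE.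
apply/subsetP=> z; rewrite !inE => xz.
case/andP: xl live_u0 => xA _ /andP[u0A _].
have := neighborhoods_nested _ u0y xz; rewrite (negPf nxy) orbF; apply.
by rewrite !A_side.
Qed.

Lemma adj_live x y : x \in A -> adj x y -> live x.
Proof. by move=> xA xy; rewrite /live xA; apply/existsP; exists y. Qed.

(** Witnesses [x], [x'] of a failure form a forbidden pattern with [r]: $F_5$ if [x'] misses [y],
    two heavy rows if [x = x'], and otherwise $F_4$ or $F_2$, depending on whether one of the two
    given negative edges at [r] avoids both [y] and [y']. *)
Lemma heavy_row_clearable r y1 y2 : r \in A -> y1 != y2 ->
  adj u0 y1 -> adj u0 y2 -> neg r y1 -> neg r y2 -> clearable A r.
Proof.
move=> rA y12 u01 u02 r1 r2; apply: contraT => /(not_clearable A_side).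
case=> y [y' [x [x' [[ry ry' yy'] [xA xr xy xy'] [x'A x'r x'y' x'y]]]]].
have xl := adj_live xA xy; have x'l := adj_live x'A x'y'.
have rl := adj_live rA ry.
have [ax'y|nax'y] := boolP (adj x' y); last first.
  have [z [u0z rz zy']] : exists z, [/\ adj u0 z, neg r z & z != y'].
    have [e|] := eqVneq y1 y'; last by exists y1.
    by exists y2; split=> //; rewrite -e eq_sym.
  exfalso; apply: (@no_F5 x' x r y' z y) => //; rewrite 1?eq_sym //;
    try by apply: min_row_sub.
have nx'y := x'y ax'y.
have [e|xx'] := eqVneq x x'.
  subst x'; exfalso.
  by apply: (@no_two_heavy x r y y' y1 y2) => //; apply: min_row_sub.
exfalso.
have third z : adj u0 z -> neg r z -> z != y -> z != y' -> False.
  move=> u0z rz zy zy'; apply: (@no_F4 x x' r y' y z) => //; rewrite 1?eq_sym //;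
    try by [apply: neg_adj | apply: min_row_sub].
have [e1|d1] := eqVneq y1 y.
  have [e2|d2] := eqVneq y2 y'.
    (* The pattern is transposed: the columns [y], [y'] form its part of size two. *)
    subst y1 y2; apply: (@no_F2 y y' x' r x) => //; rewrite 1?[neg _ _]negC 1?[adj _ _]adjC //;
      by rewrite eq_sym.
  by apply: (third y2) => //; rewrite -e1 eq_sym.
have [e1'|d1'] := eqVneq y1 y'; last exact: (third y1).
have [e2|d2] := eqVneq y2 y.
  subst y1 y2; apply: (@no_F2 y y' x' r x) => //; rewrite 1?[neg _ _]negC 1?[adj _ _]adjC //;
    by rewrite eq_sym.
by apply: (third y2) => //; rewrite -e1' eq_sym.
Qed.

(** For a live row, [min_row_sub] turns this inclusion into equality with the neighborhood of
    [u0]. *)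
Definition thin x := [forall y, adj x y ==> adj u0 y].

Lemma thinPn x : ~~ thin x -> exists y, adj x y && ~~ adj u0 y.
Proof. by case/forallPn=> y; rewrite negb_imply; exists y. Qed.

Lemma not_thin x y : adj x y -> ~~ adj u0 y -> ~~ thin x.
Proof. by move=> xy nu0y; apply/forallPn; exists y; rewrite negb_imply xy. Qed.

(** Two rows that are not thin share, by nestedness, a column outside the neighborhood of [u0]; with
    [u0] as the row missing it, this is $F_5$. *)
Lemma no_thick_matching x x' y y' : x \in A -> x' \in A -> x != x' -> y != y' ->
  ~~ thin x -> ~~ thin x' -> adj u0 y -> adj u0 y' -> neg x y -> neg x' y' -> False.
Proof.
move=> xA x'A xx' yy' nx nx' u0y u0y' xy xy'.
have [xl x'l] : live x /\ live x' by split; [exact: adj_live (neg_adj xy) | exact: adj_live (neg_adj xy')].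
have [z [xz x'z nz]] : exists z, [/\ adj x z, adj x' z & ~~ adj u0 z].
  case/thinPn: nx => z /andP[xz nz]; case/thinPn: nx' => z' /andP[x'z' nz'].
  have /orP[] : adj x z' || adj x' z by apply: neighborhoods_nested; rewrite ?A_side.
    by exists z'.
  by exists z.
by apply: (@no_F5 u0 x x' y y' z) => //; apply: min_row_sub.
Qed.

Section NothingClearable.

Hypothesis not_clear : forall u, live u -> ~~ clearable A u.

Let one_neg x y y' : x \in A -> adj u0 y -> adj u0 y' -> neg x y -> neg x y' -> y = y'.
Proof.
move=> xA u0y u0y' xy xy'; apply: contraTeq (not_clear (adj_live xA (neg_adj xy))).
by move=> yy'; rewrite negbK; apply: (@heavy_row_clearable x y y').
Qed.

(** At a thin row both witness columns are neighbors of [u0], so no witness edge can be missing and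
    both are negative. *)
Lemma thin_matching u : live u -> thin u -> exists y y' x x',
  [/\ adj u0 y, adj u0 y' & y != y'] /\
  [/\ x \in A, x != u & neg x y'] /\ [/\ x' \in A, x' != u & neg x' y].
Proof.
move=> ul /forallP ut; case: (not_clearable A_side (not_clear ul)).
move=> y [y' [x [x' [[uy uy' yy'] [xA xu xy xy'] [x'A x'u x'y' x'y]]]]].
have u0y := implyP (ut y) uy; have u0y' := implyP (ut y') uy'.
exists y, y', x, x'; split=> //; split=> //; split=> //; apply: x'y.
exact: min_row_sub (adj_live x'A x'y') u0y.
Qed.

(** The negative edges into the neighborhood of [u0] are shown to fill two columns: [y'], with at
    least two of them, and [y], with [x'] alone. Then [x'] is not thin, and its failure to be
    clearable yields a forbidden pattern. *)
Lemma no_matching_at_thin x x' y y' : x \in A -> x' \in A -> thin x ->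
  adj u0 y -> adj u0 y' -> y != y' -> neg x y' -> neg x' y -> False.
Proof.
move=> xA x'A xt u0y u0y' yy' xy' x'y.
have lv q p : q \in A -> neg q p -> live q by move=> qA /neg_adj/(adj_live qA).
have ad q p p' : q \in A -> neg q p -> adj u0 p' -> adj q p'.
  by move=> qA qp; apply: min_row_sub (lv _ _ qA qp).
have xx' : x != x'.
  by apply: contraNneq yy' => e; apply/eqP/(@one_neg x) => //; rewrite e.
(* A third column would complete an $F_4$ with the edges [x y'] and [x' y]. *)
have cols q p : q \in A -> adj u0 p -> neg q p -> p = y \/ p = y'.
  move=> qA u0p qp; have [->|py] := eqVneq p y; first by left.
  have [->|py'] := eqVneq p y'; first by right.
  have qx : q != x.
    by apply: contraNneq py' => e; apply/eqP/(@one_neg q) => //; rewrite e.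
  have qx' : q != x'.
    by apply: contraNneq py => e; apply/eqP/(@one_neg q) => //; rewrite e.
  exfalso; apply: (@no_F4 q x x' p y' y) => //; rewrite 1?eq_sym //;
    by [exact: ad qp _ | exact: ad xy' _ | exact: ad x'y _].
(* Since [x] cannot be cleared, both columns carry a negative edge to a row other than [x]. *)
have [w [wA wx wy']] : exists w, [/\ w \in A, w != x & neg w y'].
  have [z [z' [w [w' [[u0z u0z' zz'] [[wA wx wz'] [w'A w'x w'z]]]]]]] :=
    thin_matching (lv _ _ xA xy') xt.
  case: (cols w z') => // ez'; last by subst z'; exists w.
  case: (cols w' z) => // ez; last by subst z; exists w'.
  by move: zz'; rewrite ez ez' eqxx.
(* Otherwise the columns [y'] and [y] would be two heavy rows of the transposed graph. *)
have y_row q : q \in A -> neg q y -> q = x'.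
  move=> qA qy; apply/eqP/negPn/negP => qx'.
  apply: (@no_two_heavy y' y x w x' q) => //; rewrite 1?[neg _ _]negC 1?[adj _ _]adjC //;
    rewrite 1?eq_sym //; by [exact: ad xy' _ | exact: ad wy' _ | exact: ad x'y _ | exact: ad qy _].
have x'l := lv _ _ x'A x'y.
(* If [x'] were thin, its own witnesses would give a second negative edge in column [y]. *)
have x'_thick : ~~ thin x'.
  apply/negP => x't.
  have [z [z' [v [v' [[u0z u0z' zz'] [[vA vx' vz'] [v'A v'x' v'z]]]]]]] :=
    thin_matching x'l x't.
  case: (cols v z') => // ez'.
    by move: vx'; rewrite (y_row v) ?eqxx // -ez'.
  case: (cols v' z) => // ez.
    by move: v'x'; rewrite (y_row v') ?eqxx // -ez.
  by move: zz'; rewrite ez ez' eqxx.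
have wt : thin w.
  apply/negPn/negP => nw; apply: (@no_thick_matching w x' y' y) => //; last by rewrite eq_sym.
  by apply: contraNneq yy' => e; apply/eqP/(@one_neg w) => //; rewrite e.
case: (not_clearable A_side (not_clear x'l)).
move=> p [p' [q [q' [[rp rp' pp'] [qA qr qp qp'] [q'A q'r q'p' q'p]]]]].
have p_y : p' != y by apply: contraNneq qr => e; apply/eqP/y_row; rewrite // -e.
have nonadj_thin v z : thin v -> ~~ adj u0 z -> ~~ adj v z.
  by move=> /forallP/(_ z) vt; apply: contra => vz; rewrite vz in vt.
(* This treats witnesses with a column [c] outside the neighborhood of [u0]: distinct rows give
   $F_4$. A common row gives $F_5$ or, when [c'] lies outside too, $F_6$ with the thin rows [x],
   [w]. *)
have both s s' c c' : s \in A -> s' \in A -> s != x' -> s' != x' -> c != c' ->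
    adj x' c -> adj x' c' -> neg s c -> neg s' c' -> adj s c' -> adj s' c ->
    ~~ adj u0 c -> False.
  move=> sA s'A sr s'r cc' rc rc' sc s'c' sc' s'c nc.
  have c'y : c' != y by apply: contraNneq s'r => e; apply/eqP/y_row; rewrite // -e.
  have cy : c != y by apply: contraNneq nc => ->.
  have [e|ss'] := eqVneq s s'; last first.
    apply: (@no_F4 x' s s' y c c') => //; rewrite 1?eq_sym //;
      by [exact: ad sc _ | exact: ad s'c' _].
  subst s'; have s_thick := not_thin s'c nc.
  have [u0c'|nc'] := boolP (adj u0 c').
    exact: (@no_thick_matching s x' c' y).
  apply: (@no_F6 x w x' s y' y c c') => //; rewrite 1?eq_sym //;
    by [exact: nonadj_thin | exact: ad xy' _ | exact: ad wy' _ | exact: ad sc _ | exact: ad x'y _].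
have [aq'p|nq'p] := boolP (adj q' p); last first.
  have q'l := adj_live q'A q'p'.
  by apply: (@no_F5 q' q x' p' y p) => //;
    by [exact: min_row_sub q'l _ | exact: ad qp' _].
have nq'p := q'p aq'p.
have [u0p|np] := boolP (adj u0 p); last first.
  apply: (both q' q p p') => //.
have [u0p'|np'] := boolP (adj u0 p'); last first.
  by apply: (both q q' p' p) => //; rewrite eq_sym.
(* Both columns are now neighbors of [u0]; neither can be [y], so both would equal [y']. *)
case: (cols q' p) => // ep; first by move: q'r; rewrite (y_row q') ?eqxx // -ep.
case: (cols q p') => // ep'; first by rewrite ep' eqxx in p_y.
by rewrite ep ep' eqxx in pp'.
Qed.

(** [u0] is thin, so its witnesses give two negative edges into its own neighborhood; the cases
    where one of their rows is thin and where neither is are both excluded. *)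
Lemma min_row_clearable_absurd : False.
Proof.
have u0t : thin u0 by apply/forallP=> y; apply/implyP.
have [y [y' [x [x' [[u0y u0y' yy'] [[xA _ xy'] [x'A _ x'y]]]]]]] :=
  thin_matching live_u0 u0t.
have [xt|nx] := boolP (thin x); first exact: (@no_matching_at_thin x x' y y').
have y'y : y' != y by rewrite eq_sym.
have [x't|nx'] := boolP (thin x'); first exact: (@no_matching_at_thin x' x y' y).
apply: (@no_thick_matching x x' y' y) => //.
by apply: contraNneq yy' => e; apply/eqP/(@one_neg x) => //; rewrite e.
Qed.

End NothingClearable.
End LiveRows.

Lemma clearable_exists (A : {set T}) : {in A, forall x, side x} ->
  (exists x, live A x) -> exists u, live A u && clearable A u.
Proof.
move=> A_side [x xl]; apply/existsP/contraT => /existsPn none.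
pose deg x := #|[set y | adj x y]|.
have [u0 u0l u0min] := arg_minnP deg xl.
case: (@min_row_clearable_absurd A A_side u0 u0l u0min) => u ul.
by have := none u; rewrite ul.
Qed.

(** * Assembling the deletion order from clearable rows *)

Fixpoint elimination (D s : seq (T * T)) : bool :=
  if s is e :: s' then
    signed_simplicial side (del_edges adj D) neg e.1 e.2 && elimination (rcons D e) s'
  else true.

(** Carrying the deleted edges in [D] lets the orders of successive rows be concatenated. *)
Lemma elimination_cat D s1 s2 :
  elimination D (s1 ++ s2) = elimination D s1 && elimination (D ++ s1) s2.
Proof.
elim: s1 D => [|e s1 IH] D /=; first by rewrite cats0.
by rewrite IH cat_rcons andbA.
Qed.

Section RowElimination.

Variables (A : {set T}) (u : T) (D : seq (T * T)).
Hypothesis A_side : {in A, forall x, side x}.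
Hypothesis uA : u \in A.
Hypothesis D_dead : forall x y, ((x, y) \in D) = [&& side x, adj x y & x \notin A].

(** [pre] lists the columns already deleted at [u]. When [u v] is deleted, any other row still
    adjacent to [v] lies in [A], and any other column still adjacent to [u] comes later and
    dominates [v], which supplies the required positive edge. *)
Lemma row_elimination_from pre c : uniq (pre ++ c) ->
  (forall v, (v \in pre ++ c) = adj u v) -> pairwise (dominates A u) c ->
  elimination (D ++ [seq (u, v) | v <- pre]) [seq (u, v) | v <- c].
Proof.
elim: c pre => [|v c IH] pre //= pre_c_uniq pre_c_adj /andP[/allP v_dom c_dom].
rewrite rcons_cat -map_rcons IH ?cat_rcons // andbT.
set E := D ++ _.
have uv_inj : injective (fun v : T => (u, v)) by move=> ? ? [].
have ED x y : ((x, y) \in E) = ((x, y) \in D) || (x == u) && (y \in pre).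
  rewrite mem_cat; congr (_ || _); have [->|xu] := eqVneq x u; first exact: mem_map.
  by apply/negP => /mapP[z _ [xu']]; rewrite xu' eqxx in xu.
have uv : adj u v by rewrite -pre_c_adj mem_cat mem_head orbT.
have E_side x y : adj x y -> ~~ side x -> (x, y) \notin E.
  move=> xy sx; rewrite ED D_dead (negPf sx) /=.
  by apply: contra sx => /andP[/eqP-> _]; apply: A_side.
have v_side : ~~ side v by rewrite (adj_side uv) A_side.
have v_pre : v \notin pre.
  by move: pre_c_uniq; rewrite cat_uniq /= negb_or => /and3P[_ /andP[]].
apply/signed_simplicialP.
  by rewrite /del_edges uv ED D_dead uA eqxx (negPf v_pre) !andbF E_side // adjC.
move=> x y xu yv /and3P[xv xvE _] /and3P[uy uyE _].
have sx : side x by move: v_side; rewrite (adj_side xv) negbK.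
have xA : x \in A.
  by move: xvE; rewrite ED D_dead sx xv /= negb_or negbK => /andP[].
have yc : y \in c.
  move: uyE; rewrite ED eqxx negb_or => /andP[_ /= ypre].
  by move: uy; rewrite -pre_c_adj mem_cat inE (negPf ypre) (negPf yv).
have /forallP/(_ x) := v_dom y yc; rewrite xA xu xv /= => /andP[xy ->].
rewrite /del_edges xy ED D_dead xA (negPf xu) !andbF E_side 1?adjC //.
by rewrite (adj_side uy) A_side.
Qed.

Lemma row_elimination : clearable A u ->
  exists c, [/\ uniq c, (forall v, (v \in c) = adj u v) &
    elimination D [seq (u, v) | v <- c]].
Proof.
(* Domination need not be reflexive; adding equality makes it total on the neighbors of [u], so they
   can be sorted. *)
move=> u_clear; pose leT := [rel y y' | (y == y') || dominates A u y y'].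
have leT_trans : transitive leT.
  move=> y2 y1 y3 /= /orP[/eqP->//|d12] /orP[/eqP<-|d23]; first by rewrite d12 orbT.
  apply/orP; right; apply/forallP=> x; apply/implyP=> xA; apply/implyP=> xu; apply/implyP=> xy1.
  have /forallP/(_ x) := d12; rewrite xA xu xy1 => /andP[xy2 _].
  by have /forallP/(_ x) := d23; rewrite xA xu xy2.
have leT_total : {in adj u &, total leT}.
  move=> y y' uy uy' /=; rewrite [y' == y]eq_sym; have [//|yy'] /= := eqVneq y y'.
  by have /forallP/(_ y)/forallP/(_ y') := u_clear; rewrite yy' [adj u y]uy [adj u y']uy'.
pose c := sort leT (enum (adj u)).
have c_uniq : uniq c by rewrite sort_uniq enum_uniq.
have c_adj v : (v \in c) = adj u v by rewrite mem_sort mem_enum.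
exists c; split=> //.
have := @row_elimination_from [::] c c_uniq c_adj; rewrite cats0; apply.
have : pairwise leT c.
  rewrite -sorted_pairwise //; apply: (sort_sorted_in leT_total).
  by apply/allP=> y; rewrite mem_enum.
move: c_uniq; rewrite uniq_pairwise => c_neq c_le.
have := conj c_neq c_le => /andP; rewrite -pairwise_relI.
by apply: sub_pairwise => y y' /= /andP[/negPf->].
Qed.

End RowElimination.

(** Induction on a bound for the number of rows left: a clearable row is deleted first. If no row of
    [A] is live, no edge remains. *)
Lemma elimination_exists n (A : {set T}) D : #|A| <= n ->
  {in A, forall x, side x} ->
  (forall x y, ((x, y) \in D) = [&& side x, adj x y & x \notin A]) ->
  exists s, [/\ uniq s, (forall x y, ((x, y) \in s) = [&& side x, adj x y & x \in A]) &
    elimination D s].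
Proof.
elim: n A D => [|n IH] A D leAn A_side D_dead.
  exists [::]; split=> // x y; move: leAn; rewrite leqn0 cards_eq0 => /eqP->.
  by rewrite !inE !andbF.
have [/existsP A_live|/existsPn A_dead] := boolP [exists x, live A x]; last first.
  exists [::]; split=> // x y; rewrite in_nil; apply/esym/negP => /and3P[_ xy xA].
  by have /negP[] := A_dead x; apply: adj_live xy.
have [u /andP[ul u_clear]] := clearable_exists A_side A_live.
have uA : u \in A by case/andP: ul.
have [c [c_uniq c_adj c_elim]] := row_elimination A_side uA D_dead u_clear.
have uv_inj : injective (fun v : T => (u, v)) by move=> ? ? [].
have c_mem x y : ((x, y) \in [seq (u, v) | v <- c]) = (x == u) && adj u y.
  have [->|xu] := eqVneq x u; first by rewrite mem_map.
  by apply/negP => /mapP[z _ [xu']]; rewrite xu' eqxx in xu.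
have [||x y|s [s_uniq s_mem s_elim]] :=
  IH (A :\ u) (D ++ [seq (u, v) | v <- c]).
- by move: leAn; rewrite (cardsD1 u) uA.
- by move=> x /setD1P[_ /A_side].
- rewrite mem_cat D_dead c_mem !inE negb_and negbK; have [->|] //= := eqVneq x u.
    by rewrite A_side // uA !andbF andbT.
  by rewrite orbF.
exists ([seq (u, v) | v <- c] ++ s); split.
- rewrite cat_uniq map_inj_uniq // c_uniq s_uniq andbT /=.
  apply/hasPn=> -[x y]; rewrite s_mem c_mem !inE => /and4P[_ _ xu _].
  by rewrite (negPf xu).
- move=> x y; rewrite mem_cat c_mem s_mem !inE; have [->|] //= := eqVneq x u.
  by rewrite uA A_side // !andbF orbF andbT.
by rewrite elimination_cat c_elim.
Qed.

Lemma free_chordal : chordal side adj neg.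
Proof.
have [||x y|s [s_uniq s_mem s_elim]] := @elimination_exists #|[set x | side x]| [set x | side x] [::].
- by [].
- by move=> x; rewrite inE.
- by rewrite inE; case: (side x); rewrite ?andbF.
exists s; split.
  apply: uniq_perm => //; first by rewrite filter_uniq ?enum_uniq.
  move=> [x y]; rewrite s_mem mem_filter mem_enum inE /=.
  by case: (side x); rewrite ?andbT.
move=> s1 s2 e s_eq; move: s_elim; rewrite s_eq elimination_cat /=.
by case/and3P.
Qed.

End SignedBigraph.

Theorem theorem3p2 (T : finType) (side : T -> bool) (adj neg : rel T) :
  signed_bigraph side adj neg ->
  ~ separable adj ->
  (chordal side adj neg <->
   ~ (contains_family adj neg 2 2 F1_ab F1_neg \/
      contains_family adj neg 2 3 F2_ab F2_neg \/
      contains_family adj neg 2 4 F3_ab F3_neg \/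
      contains_family adj neg 3 3 F4_ab F4_neg \/
      contains_family adj neg 3 3 F5_ab F5_neg \/
      contains_family adj neg 4 4 F6_ab F6_neg)).
Proof.
move=> bigraph nonsep; split=> [ch|]; last exact: free_chordal.
(* For each pattern, [stuck] and the presence of the last corner edge are checked by computation. *)
by case=> [|[|[|[|[|]]]]] h; apply: (stuck_not_chordal bigraph _ _ h ch).
Qed.
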